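(* Let $\mu$ be a permuton. Then the permuton ideal $I_\mu$ is a two-sided ideal of $\Lambda$.
   Context: Let $\Bbbk$ be an algebraically closed field. $\Lambda_{\mathbb{R}}$ is the $\Bbbk$-linear category with objects the real numbers (plus a zero object) generated by morphisms $\alpha_{yx}:x\to y$ and $\alpha^*_{xy}:y\to x$ for $x<y$, with $\alpha_{xx}=\alpha^*_{xx}=1_x$, subject to: (1) $\alpha_{zy}\alpha_{yx}=\alpha_{zx}$ and $\alpha^*_{xy}\alpha^*_{yz}=\alpha^*_{xz}$ for $x\le y\le z$; (2) $\alpha^*_{x+a-b,x+a}\alpha_{x+a,x}=\alpha_{x+a-b,x-b}\alpha^*_{x-b,x}$ for $a,b>0$. $\Lambda=\Lambda_{(0,1)}$ is the quotient category of $\Lambda_{\mathbb{R}}$ obtained by setting every object $x\notin(0,1)$ isomorphic to zero. A morphism of $\Lambda$ is path like if it is a nonzero composition of $\alpha$'s and $\alpha^*$'s; the length of $\alpha_{yx}$ and of $\alpha^*_{xy}$ is $|x-y|$ and the length of a composition is the sum of the lengths. Path like morphisms $x\to y$ are determined by their length and form a basis of $\operatorname{Hom}_\Lambda(x,y)$. $P_y=\operatorname{Hom}_\Lambda(y,-)$ for $y\in(0,1)$. We also regard $\Lambda$ as the (non-unital) algebra $\bigoplus_{y\in(0,1)}P_y=\bigoplus_{x,y\in(0,1)}\operatorname{Hom}_\Lambda(y,x)$ with multiplication given by composition; a two-sided ideal is a family of subspaces of the spaces $\operatorname{Hom}_\Lambda(y,x)$ closed under pre- and post-composition with arbitrary morphisms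 of $\Lambda$. A permuton is a measure $\mu$ on the Borel sets of $[0,1]\times[0,1]$ with $\mu([0,k]\times[0,1])=k=\mu([0,1]\times[0,k])$ for all $k\in[0,1]$. For $y\in(0,1)$ let $f_{\mu,y}(x)=-2\mu([0,x]\times[0,y])+y+x$, and let $D_{f_{\mu,y}}\subseteq P_y$ be the submodule with $D_{f_{\mu,y}}(x)$ spanned by the path like morphisms $y\to x$ of length at least $f_{\mu,y}(x)$. The permuton ideal is $I_\mu=\bigoplus_{y\in(0,1)}D_{f_{\mu,y}}\subseteq\bigoplus_{y\in(0,1)}P_y$. *)

(* Defs.v *)
From HB Require Import structures.
From mathcomp Require Import all_boot all_order all_algebra.
From mathcomp Require Import all_classical all_reals all_analysis.

Set Implicit Arguments.
Unset Strict Implicit.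
Unset Printing Implicit Defensive.

Import Order.TTheory GRing.Theory Num.Theory.
Local Open Scope classical_set_scope.
Local Open Scope ring_scope.
Local Open Scope quotient_scope.

Section Presentation.
Variables (R : realType) (k : fieldType).

(* [Some x] is the real number [x]; [None] is the additional zero object. *)
Definition obj : Type := option R.

(* Formal k-linear expressions in the generators
   [tAlpha x y] : x -> y, written alpha_{yx}, and
   [tStar x y]  : y -> x, written alpha^*_{xy}   (x <= y in both cases). *)
Inductive term : obj -> obj -> Type :=
| tId (X : obj) : term X X
| tAlpha (x y : R) : x <= y -> term (Some x) (Some y)
| tStar (x y : R) : x <= y -> term (Some y) (Some x)
| tComp (X Y Z : obj) : term Y Z -> term X Y -> term X Z
| tZero (X Y : obj) : term X Y
| tAdd (X Y : obj) : term X Y -> term X Y -> term X Y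
| tScale (X Y : obj) : k -> term X Y -> term X Y.

Definition relations : Type := forall X Y : obj, term X Y -> term X Y -> Prop.

(* The smallest k-linear congruence containing [B] and the axioms of a k-linear
   category. *)
Inductive cong (B : relations) : relations :=
| cong_base X Y (s t : term X Y) : B X Y s t -> cong B s t
| cong_refl X Y (s : term X Y) : cong B s s
| cong_sym X Y (s t : term X Y) : cong B s t -> cong B t s
| cong_trans X Y (s t u : term X Y) : cong B s t -> cong B t u -> cong B s u
| cong_comp X Y Z (s s' : term Y Z) (t t' : term X Y) :
    cong B s s' -> cong B t t' -> cong B (tComp s t) (tComp s' t')
| cong_add X Y (s s' t t' : term X Y) :
    cong B s s' -> cong B t t' -> cong B (tAdd s t) (tAdd s' t')
| cong_scale X Y (a : k) (s s' : term X Y) :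
    cong B s s' -> cong B (tScale a s) (tScale a s')
| cong_addA X Y (s t u : term X Y) :
    cong B (tAdd s (tAdd t u)) (tAdd (tAdd s t) u)
| cong_addC X Y (s t : term X Y) : cong B (tAdd s t) (tAdd t s)
| cong_add0 X Y (s : term X Y) : cong B (tAdd (tZero X Y) s) s
| cong_addN X Y (s : term X Y) : cong B (tAdd (tScale (-1) s) s) (tZero X Y)
| cong_scaleA X Y (a b : k) (s : term X Y) :
    cong B (tScale a (tScale b s)) (tScale (a * b) s)
| cong_scale1 X Y (s : term X Y) : cong B (tScale 1 s) s
| cong_scaleDr X Y (a : k) (s t : term X Y) :
    cong B (tScale a (tAdd s t)) (tAdd (tScale a s) (tScale a t))
| cong_scaleDl X Y (a b : k) (s : term X Y) :
    cong B (tScale (a + b) s) (tAdd (tScale a s) (tScale b s))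
| cong_compA X Y Z W (s : term Z W) (t : term Y Z) (u : term X Y) :
    cong B (tComp s (tComp t u)) (tComp (tComp s t) u)
| cong_idl X Y (s : term X Y) : cong B (tComp (tId Y) s) s
| cong_idr X Y (s : term X Y) : cong B (tComp s (tId X)) s
| cong_compDl X Y Z (s s' : term Y Z) (t : term X Y) :
    cong B (tComp (tAdd s s') t) (tAdd (tComp s t) (tComp s' t))
| cong_compDr X Y Z (s : term Y Z) (t t' : term X Y) :
    cong B (tComp s (tAdd t t')) (tAdd (tComp s t) (tComp s t'))
| cong_compZl X Y Z (a : k) (s : term Y Z) (t : term X Y) :
    cong B (tComp (tScale a s) t) (tScale a (tComp s t))
| cong_compZr X Y Z (a : k) (s : term Y Z) (t : term X Y) :
    cong B (tComp s (tScale a t)) (tScale a (tComp s t)).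

End Presentation.

Section PresentedCategory.
Variables (R : realType) (k : fieldType) (B : relations R k).

Section HomSpace.
Variables X Y : obj R.

Definition congb : rel {classic (term k X Y)} := fun s t => `[< cong B s t >].

Lemma congb_refl : reflexive congb.
Proof. by move=> s; apply/asboolP; exact: cong_refl. Qed.

Lemma congb_sym : symmetric congb.
Proof. by move=> s t; apply/asboolP/asboolP => /cong_sym. Qed.

Lemma congb_trans : transitive congb.
Proof.
by move=> t s u /asboolP st /asboolP tu; apply/asboolP; exact: cong_trans tu.
Qed.

Canonical congb_equiv := EquivRel congb congb_refl congb_sym congb_trans.

Definition Mor : Type := {eq_quot congb}.
HB.instance Definition _ : EqQuotient _ congb Mor := EqQuotient.on Mor.
HB.instance Definition _ := Choice.on Mor.

Definition mor (t : term k X Y) : Mor := \pi_Mor (t : {classic (term k X Y)}).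

Lemma morP (s t : term k X Y) : mor s = mor t <-> cong B s t.
Proof.
by split=> [/eqmodP/asboolP//|st]; apply/eqmodP/asboolP.
Qed.

Lemma mor_repr (f : Mor) : mor (repr f) = f.
Proof. exact: reprK. Qed.

Lemma morK (t : term k X Y) : cong B (repr (mor t)) t.
Proof. by apply/morP; rewrite mor_repr. Qed.

Lemma mor_surj (f : Mor) : exists t, f = mor t.
Proof. by exists (repr f); rewrite mor_repr. Qed.

Definition hom_zero : Mor := mor (tZero k X Y).
Definition hom_add (f g : Mor) : Mor := mor (tAdd (repr f) (repr g)).
Definition hom_scale (a : k) (f : Mor) : Mor := mor (tScale a (repr f)).
Definition hom_opp (f : Mor) : Mor := hom_scale (-1) f.

Lemma hom_addE s t : hom_add (mor s) (mor t) = mor (tAdd s t).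
Proof. by apply/morP; apply: cong_add; exact: morK. Qed.

Lemma hom_scaleE a s : hom_scale a (mor s) = mor (tScale a s).
Proof. by apply/morP; apply: cong_scale; exact: morK. Qed.

Lemma hom_addA : associative hom_add.
Proof.
move=> f g h; have [s ->] := mor_surj f; have [t ->] := mor_surj g.
have [u ->] := mor_surj h; rewrite !hom_addE; apply/morP; exact: cong_addA.
Qed.

Lemma hom_addC : commutative hom_add.
Proof.
move=> f g; have [s ->] := mor_surj f; have [t ->] := mor_surj g.
rewrite !hom_addE; apply/morP; exact: cong_addC.
Qed.

Lemma hom_add0 : left_id hom_zero hom_add.
Proof.
move=> f; have [s ->] := mor_surj f.
rewrite hom_addE; apply/morP; exact: cong_add0.
Qed.

Lemma hom_addN : left_inverse hom_zero hom_opp hom_add.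
Proof.
move=> f; have [s ->] := mor_surj f.
rewrite /hom_opp hom_scaleE hom_addE; apply/morP; exact: cong_addN.
Qed.

HB.instance Definition _ :=
  GRing.isZmodule.Build Mor hom_addA hom_addC hom_add0 hom_addN.

Lemma hom_scaleA a b (f : Mor) :
  hom_scale a (hom_scale b f) = hom_scale (a * b) f.
Proof.
have [s ->] := mor_surj f.
rewrite !hom_scaleE; apply/morP; exact: cong_scaleA.
Qed.

Lemma hom_scale1 : left_id 1 hom_scale.
Proof.
move=> f; have [s ->] := mor_surj f.
rewrite hom_scaleE; apply/morP; exact: cong_scale1.
Qed.

Lemma hom_scaleDr : right_distributive hom_scale +%R.
Proof.
move=> a f g; have [s ->] := mor_surj f; have [t ->] := mor_surj g.
change (hom_scale a (hom_add (mor s) (mor t)) =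
        hom_add (hom_scale a (mor s)) (hom_scale a (mor t))).
rewrite !(hom_scaleE, hom_addE); apply/morP; exact: cong_scaleDr.
Qed.

Lemma hom_scaleDl f : {morph hom_scale^~ f : a b / a + b}.
Proof.
move=> a b; have [s ->] := mor_surj f.
change (hom_scale (a + b) (mor s) =
        hom_add (hom_scale a (mor s)) (hom_scale b (mor s))).
rewrite !(hom_scaleE, hom_addE); apply/morP; exact: cong_scaleDl.
Qed.

HB.instance Definition _ := GRing.Zmodule_isLmodule.Build k Mor
  hom_scaleA hom_scale1 hom_scaleDr hom_scaleDl.

End HomSpace.

Definition mcomp X Y Z (g : Mor Y Z) (f : Mor X Y) : Mor X Z :=
  mor (tComp (repr g) (repr f)).

Lemma compE X Y Z (s : term k Y Z) (t : term k X Y) :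
  mcomp (mor s) (mor t) = mor (tComp s t).
Proof. by apply/morP; apply: cong_comp; exact: morK. Qed.

Definition alpha (x y : R) (xy : x <= y) : Mor (Some x) (Some y) :=
  mor (tAlpha k xy).
Definition star (x y : R) (xy : x <= y) : Mor (Some y) (Some x) :=
  mor (tStar k xy).

(* [composite f l]: [f] is a composition of alpha's and alpha^*'s whose lengths
   add up to [l]. *)
Inductive composite : forall X Y : obj R, Mor X Y -> R -> Prop :=
| composite_alpha x y (xy : x <= y) : composite (alpha xy) `|x - y|
| composite_star x y (xy : x <= y) : composite (star xy) `|x - y|
| composite_comp X Y Z (g : Mor Y Z) (f : Mor X Y) l m :
    composite g l -> composite f m -> composite (mcomp g f) (l + m).

(* [f] is path like and [l] is its length. *)
Definition path_like X Y (f : Mor X Y) (l : R) : Prop :=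
  f != 0 /\ composite f l.

End PresentedCategory.

Arguments Mor {R k} B X Y.

Section Lambda.
Variables (R : realType) (k : fieldType).

Inductive rel_LambdaR : relations R k :=
| rel_alpha1 x (xx : x <= x) : rel_LambdaR (tAlpha k xx) (tId k (Some x))
| rel_star1 x (xx : x <= x) : rel_LambdaR (tStar k xx) (tId k (Some x))
| rel_alphaM x y z (xy : x <= y) (yz : y <= z) (xz : x <= z) :
    rel_LambdaR (tComp (tAlpha k yz) (tAlpha k xy)) (tAlpha k xz)
| rel_starM x y z (xy : x <= y) (yz : y <= z) (xz : x <= z) :
    rel_LambdaR (tComp (tStar k xy) (tStar k yz)) (tStar k xz)
| rel_mesh x a b (xxa : x <= x + a) (xab_xa : x + a - b <= x + a)
    (xb_xab : x - b <= x + a - b) (xb_x : x - b <= x) :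
    0 < a -> 0 < b ->
    rel_LambdaR (tComp (tStar k xab_xa) (tAlpha k xxa))
                (tComp (tAlpha k xb_xab) (tStar k xb_x))
| rel_zero_object : rel_LambdaR (tId k None) (tZero k None None).

(* An object of a k-linear category is zero iff its identity is zero, so the
   quotient of Lambda_R making the objects outside (0,1) zero has these
   additional relations. *)
Inductive rel_Lambda : relations R k :=
| rel_of_LambdaR X Y (s t : term k X Y) :
    rel_LambdaR s t -> rel_Lambda s t
| rel_kill x : ~ (x \in `]0, 1[) ->
    rel_Lambda (tId k (Some x)) (tZero k (Some x) (Some x)).

Definition pt : Type := `]0%R, 1%R[%classic : set R.

Definition Lambda (y x : pt) : lmodType k :=
  Mor rel_Lambda (Some (\val y)) (Some (\val x)).

(* Only the objects of (0,1) index a family: all others are zero in Lambda. *)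
Definition mor_family : Type := forall y x : pt, set (Lambda y x).

Definition two_sided_ideal (J : mor_family) : Prop :=
  [/\ forall y x, submod_closed (mem (J y x)),
      forall y x z (g : Lambda x z) (f : Lambda y x),
        J y x f -> J y z (mcomp g f)
    & forall z y x (f : Lambda y x) (h : Lambda z y),
        J y x f -> J z x (mcomp f h)].

End Lambda.

Definition lin_span (k : fieldType) (V : lmodType k) (S : set V) : set V :=
  [set v | exists (n : nat) (c : 'I_n -> k) (w : 'I_n -> V),
     (forall i, S (w i)) /\ v = \sum_i c i *: w i].

(* The submodule D_f of P_y = Hom(y, -), evaluated at x. *)
Definition Dsub (R : realType) (k : fieldType) (f : R -> R) (y x : pt R) :
    set (Lambda k y x) :=
  lin_span [set p : Lambda k y x | exists2 l, f (\val x) <= l & path_like p l].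

Arguments Dsub {R} k f y x.

Section Permuton.
Variable R : realType.

(* [0,1] with its Borel sigma-algebra, i.e. the trace of the one of R. *)
Definition unitI : Type := `[0%R, 1%R]%classic : set R.

Lemma unitI0_subproof : (0 : R) \in `[0%R, 1%R]%classic.
Proof. by rewrite inE /= in_itv /= lexx ler01. Qed.

HB.instance Definition _ := Choice.on unitI.
HB.instance Definition _ := isPointed.Build unitI (SigSub unitI0_subproof).

Definition unitI_val (u : unitI) : measurableTypeR R := \val u.
Definition borelI := g_sigma_algebra_preimageType unitI_val.

Definition initI (r : R) : set borelI := [set u | unitI_val u <= r].

Definition permuton (mu : {measure set (borelI * borelI) -> \bar R}) : Prop :=
  forall r, 0 <= r <= 1 ->
    mu (initI r `*` setT) = r%:E /\ mu (setT `*` initI r) = r%:E.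

Definition permuton_fun (mu : {measure set (borelI * borelI) -> \bar R})
    (y x : R) : R :=
  - 2 * fine (mu (initI x `*` initI y)) + y + x.

Definition permuton_ideal (k : fieldType)
    (mu : {measure set (borelI * borelI) -> \bar R}) : mor_family R k :=
  fun y x => Dsub k (permuton_fun mu (\val y)) y x.

End Permuton.

Arguments permuton_ideal {R} k mu y x.

(* Main.v *)
Require Import Defs.
From mathcomp Require Import all_boot all_order all_algebra.
From mathcomp Require Import all_classical all_reals all_analysis.
From mathcomp Require Import lra.

(** The ideal property comes down to one numerical fact: the function
    [permuton_fun mu y x] = y + x - 2 mu([0,x] x [0,y]) is 1-Lipschitz in x and
    in y on [0,1].  Indeed, when x grows to z, the term y + x grows by z - x,
    while the measure of [0,x] x [0,y] grows by something between 0 and the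
    measure of the strip ]x,z] x [0,1], which is z - x because the first marginal
    of mu is uniform ([permuton_fun_lip1]); the second marginal gives the other
    variable ([permuton_fun_lip2]).

    On the algebraic side, every morphism is a linear combination of composites
    of alpha's and alpha^*'s ([composite_span]), and a composite from x to z has
    length at least |x - z| by the triangle inequality ([composite_length]).
    Composing a path like morphism y -> x of length at least
    [permuton_fun mu y x] with a composite x -> z therefore gives either zero or
    a path like morphism whose length is at least
    [permuton_fun mu y x] + |x - z|, hence at least [permuton_fun mu y z];
    precomposition is the same with the roles of the two variables exchanged.
    Bilinearity of the composition ([lin_span_mcomp]) extends this to all
    morphisms. *)

Set Implicit Arguments.
Unset Strict Implicit.
Unset Printing Implicit Defensive.

Import Order.TTheory GRing.Theory Num.Theory.
Local Open Scope classical_set_scope.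
Local Open Scope ring_scope.

(** * Linear spans *)

Section LinSpan.
Variables (k : fieldType) (V : lmodType k).
Implicit Type S : set V.

Lemma lin_span0 S : lin_span S 0.
Proof.
by exists 0%N, (fun=> 0), (fun=> 0); split; [case | rewrite big_ord0].
Qed.

Lemma sub_lin_span S : S `<=` lin_span S.
Proof.
move=> v Sv; exists 1%N, (fun=> 1), (fun=> v); split=> //.
by rewrite big_ord1 scale1r.
Qed.

Lemma lin_spanD S u v : lin_span S u -> lin_span S v -> lin_span S (u + v).
Proof.
move=> [n [c [w [Sw ->]]]] [m [d [x [Sx ->]]]].
exists (n + m)%N,
  (fun i => match fintype.split i with inl j => c j | inr j => d j end),
  (fun i => match fintype.split i with inl j => w j | inr j => x j end).
split=> [i|]; first by case: (fintype.split i).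
rewrite big_split_ord /=; congr (_ + _); apply: eq_bigr => i _.
  by rewrite (unsplitK (inl i)).
by rewrite (unsplitK (inr i)).
Qed.

Lemma lin_spanZ S a v : lin_span S v -> lin_span S (a *: v).
Proof.
move=> [n [c [w [Sw ->]]]]; exists n, (fun i => a * c i), w; split=> //.
by rewrite scaler_sumr; apply: eq_bigr => i _; rewrite scalerA.
Qed.

Lemma lin_span_sum S n (w : 'I_n -> V) :
  (forall i, lin_span S (w i)) -> lin_span S (\sum_i w i).
Proof.
move=> Sw; apply: big_ind => //; first exact: lin_span0.
exact: lin_spanD.
Qed.

Lemma lin_span_submod_closed S : submod_closed (mem (lin_span S)).
Proof.
split=> [|a u v /set_mem Su /set_mem Sv]; apply/mem_set.
  exact: lin_span0.
by apply: lin_spanD => //; exact: lin_spanZ.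
Qed.

End LinSpan.

(** * Bilinear composition and composites of generators *)

Section Composition.
Variables (R : realType) (k : fieldType) (B : relations R k).
Implicit Types X Y Z : obj R.

Lemma mor_add X Y (s t : term k X Y) :
  mor B (tAdd s t) = mor B s + mor B t.
Proof. by rewrite -hom_addE. Qed.

Lemma mor_scale X Y a (s : term k X Y) : mor B (tScale a s) = a *: mor B s.
Proof. by rewrite -hom_scaleE. Qed.

Lemma mcompDl X Y Z (f : Mor B X Y) :
  {morph (@mcomp _ _ B X Y Z)^~ f : g h / g + h}.
Proof.
move=> g h; have [r ->] := mor_surj f; have [s ->] := mor_surj g.
have [t ->] := mor_surj h; rewrite -mor_add !Defs.compE -mor_add.
by apply/morP; exact: cong_compDl.
Qed.

Lemma mcompDr X Y Z (g : Mor B Y Z) :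
  {morph @mcomp _ _ B X Y Z g : f h / f + h}.
Proof.
move=> f h; have [r ->] := mor_surj f; have [s ->] := mor_surj g.
have [t ->] := mor_surj h; rewrite -mor_add !Defs.compE -mor_add.
by apply/morP; exact: cong_compDr.
Qed.

Lemma mcompZl X Y Z a (g : Mor B Y Z) (f : Mor B X Y) :
  mcomp (a *: g) f = a *: mcomp g f.
Proof.
have [r ->] := mor_surj f; have [s ->] := mor_surj g.
by rewrite -mor_scale !Defs.compE -mor_scale; apply/morP; exact: cong_compZl.
Qed.

Lemma mcompZr X Y Z a (g : Mor B Y Z) (f : Mor B X Y) :
  mcomp g (a *: f) = a *: mcomp g f.
Proof.
have [r ->] := mor_surj f; have [s ->] := mor_surj g.
by rewrite -mor_scale !Defs.compE -mor_scale; apply/morP; exact: cong_compZr.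
Qed.

Lemma mcomp0l X Y Z (f : Mor B X Y) : mcomp (0 : Mor B Y Z) f = 0.
Proof. by rewrite -(scale0r (0 : Mor B Y Z)) mcompZl scale0r. Qed.

Lemma mcomp0r X Y Z (g : Mor B Y Z) : mcomp g (0 : Mor B X Y) = 0.
Proof. by rewrite -(scale0r (0 : Mor B X Y)) mcompZr scale0r. Qed.

Lemma mcomp_suml X Y Z n (g : 'I_n -> Mor B Y Z) (f : Mor B X Y) :
  mcomp (\sum_i g i) f = \sum_i mcomp (g i) f.
Proof. exact: (big_morph _ (@mcompDl X Y Z f) (@mcomp0l X Y Z f)). Qed.

Lemma mcomp_sumr X Y Z n (g : Mor B Y Z) (f : 'I_n -> Mor B X Y) :
  mcomp g (\sum_i f i) = \sum_i mcomp g (f i).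
Proof. exact: (big_morph _ (@mcompDr X Y Z g) (@mcomp0r X Y Z g)). Qed.

(** Bilinearity of the composition: whether products land in a subspace only
    needs to be tested on spanning sets of the two factors. *)
Lemma lin_span_mcomp X Y Z (S : set (Mor B Y Z)) (T : set (Mor B X Y))
    (U : set (Mor B X Z)) (g : Mor B Y Z) (f : Mor B X Y) :
  (forall g' f', S g' -> T f' -> lin_span U (mcomp g' f')) ->
  lin_span S g -> lin_span T f -> lin_span U (mcomp g f).
Proof.
move=> STU [n [c [w [Sw ->]]]] [m [d [x [Tx ->]]]].
rewrite mcomp_suml; apply: lin_span_sum => i.
rewrite mcomp_sumr; apply: lin_span_sum => j.
by rewrite mcompZl mcompZr; do 2!apply: lin_spanZ; exact: STU.
Qed.

(** Composites go from a real number to a real number, and each generator has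
    the distance of its endpoints as length; so this is the triangle inequality.
    The endpoints are arbitrary objects to let the induction go through. *)
Lemma composite_length_obj X Y (f : Mor B X Y) l : composite f l ->
  exists x y, [/\ X = Some x, Y = Some y & `|x - y| <= l].
Proof.
elim=> [x y xy|x y xy|X1 Y1 Z1 g h l1 m1 _ IHg _ IHh].
- by exists x, y.
- by exists y, x; rewrite distrC.
- have [y [z [Yy -> yz]]] := IHg; have [x [y' [-> Yy' xy]]] := IHh.
  move: Yy'; rewrite Yy => -[yy']; exists x, z; split=> //.
  by rewrite (le_trans (ler_distD y _ _))// addrC lerD// yy'.
Qed.

Lemma composite_length x y (f : Mor B (Some x) (Some y)) l :
  composite f l -> `|x - y| <= l.
Proof. by move=> /composite_length_obj[x' [y' [[->] [->]]]]. Qed.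

End Composition.

(** By induction on the expression of a morphism.  The identity of a real number
    x is the composite alpha_{xx}, and that of the zero object is zero. *)
Lemma composite_span (R : realType) (k : fieldType) (X Y : obj R)
    (f : Mor (@rel_Lambda R k) X Y) :
  lin_span [set p : Mor (@rel_Lambda R k) X Y | exists l, composite p l] f.
Proof.
have [t ->] := mor_surj f.
elim: {X Y f} t => [[x|]|x y xy|x y xy|X Y Z s IHs t IHt|X Y|X Y s IHs t IHt
  |X Y a s IHs].
- apply: sub_lin_span; exists `|x - x|.
  have <- : alpha (@rel_Lambda R k) (lexx x) =
      mor (@rel_Lambda R k) (tId k (Some x)).
    by apply/morP/cong_base/rel_of_LambdaR; exact: rel_alpha1.
  exact: composite_alpha.
- have -> : mor (@rel_Lambda R k) (tId k None) = 0.
    by apply/morP/cong_base/rel_of_LambdaR; exact: rel_zero_object.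
  exact: lin_span0.
- by apply: sub_lin_span; exists `|x - y|; exact: composite_alpha.
- by apply: sub_lin_span; exists `|x - y|; exact: composite_star.
- rewrite -Defs.compE; apply: lin_span_mcomp IHs IHt => g f [l gl] [m fm].
  by apply: sub_lin_span; exists (l + m); exact: composite_comp.
- exact: lin_span0.
- by rewrite mor_add; exact: lin_spanD.
- by rewrite mor_scale; exact: lin_spanZ.
Qed.

(** * Lipschitz continuity of the permuton functions *)

(** The part of A' outside A contributes to E at most its full measure. *)
Lemma measure_setI_increment d (T : measurableType d) (R : realType)
    (mu : {measure set T -> \bar R}) (A A' E : set T) :
  measurable A -> measurable A' -> measurable E -> A `<=` A' ->
  (mu A' < +oo)%E ->
  0 <= fine (mu (A' `&` E)) - fine (mu (A `&` E))
    <= fine (mu A') - fine (mu A).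
Proof.
move=> mA mA' mE AA' A'oo.
have fin C : measurable C -> C `<=` A' -> mu C \is a fin_num.
  move=> mC CA'; rewrite ge0_fin_numE// (le_lt_trans _ A'oo)//.
  by apply: le_measure => //; exact/mem_set.
have mD := measurableD mA' mA.
have split_fine C : measurable C ->
    fine (mu (A' `&` C)) =
    fine (mu (A `&` C)) + fine (mu ((A' `\` A) `&` C)).
  move=> mC; rewrite -fineD.
  - rewrite -measureU//.
    + by rewrite -setIUl setDUK.
    + exact: measurableI.
    + exact: measurableI.
    + by rewrite -subset0 => t [[At _] [[_ /(_ At)]]].
  - by apply: fin; [exact: measurableI | move=> t [/AA']].
  - by apply: fin; [exact: measurableI | move=> t [[]]].
have := split_fine _ measurableT; rewrite !setIT => ->.
have addrK_l (a b : R) : a + b - a = b by rewrite addrC addKr.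
rewrite split_fine// !addrK_l fine_ge0//=.
apply: fine_le.
- by apply: fin; [exact: measurableI | move=> t [[]]].
- by apply: fin => // t [].
- apply: le_measure; [| |exact: subIsetl]; apply/mem_set => //.
  exact: measurableI.
Qed.

Lemma measurable_initI (R : realType) (r : R) : measurable (initI r).
Proof.
exists `]-oo, r]%classic; first exact: measurable_itv.
by rewrite setTI; apply/seteqP; split=> u; rewrite /initI /= in_itv.
Qed.

Lemma subset_initI (R : realType) (r s : R) : r <= s -> initI r `<=` initI s.
Proof. by move=> rs u /= /le_trans; exact. Qed.

Section PermutonFun.
Variables (R : realType) (mu : {measure set (borelI R * borelI R) -> \bar R}).
Hypothesis permuton_mu : permuton mu.

Lemma permuton_increment1 (x z y : R) : 0 <= x <= 1 -> 0 <= z <= 1 -> x <= z ->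
  0 <= fine (mu (initI z `*` initI y)) - fine (mu (initI x `*` initI y))
    <= z - x.
Proof.
move=> x01 z01 xz.
have := @measure_setI_increment _ _ _ mu (initI x `*` setT)
  (initI z `*` setT) (setT `*` initI y).
rewrite -!setXI !setIT !setTI (permuton_mu x01).1 (permuton_mu z01).1 /=.
apply; rewrite ?ltry//.
1-3: by apply: measurableX => //; exact: measurable_initI.
by move=> u [/= + _]; split=> //; exact: subset_initI xz _ _.
Qed.

Lemma permuton_increment2 (x y z : R) : 0 <= y <= 1 -> 0 <= z <= 1 -> y <= z ->
  0 <= fine (mu (initI x `*` initI z)) - fine (mu (initI x `*` initI y))
    <= z - y.
Proof.
move=> y01 z01 yz.
have := @measure_setI_increment _ _ _ mu (setT `*` initI y)
  (setT `*` initI z) (initI x `*` setT).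
rewrite -!setXI !setIT !setTI (permuton_mu y01).2 (permuton_mu z01).2 /=.
apply; rewrite ?ltry//.
1-3: by apply: measurableX => //; exact: measurable_initI.
by move=> u [/= _ +]; split=> //; exact: subset_initI yz _ _.
Qed.

(** If x <= z, the increment (z - x) - 2 m with 0 <= m <= z - x has absolute
    value at most z - x; the case z <= x is symmetric. *)
Lemma permuton_fun_lip1 (y x z : R) : 0 <= x <= 1 -> 0 <= z <= 1 ->
  permuton_fun mu y z <= `|x - z| + permuton_fun mu y x.
Proof.
move=> x01 z01; rewrite /permuton_fun; have [xz|/ltW zx] := leP x z.
  have := permuton_increment1 y x01 z01 xz.
  by rewrite ler0_norm ?subr_le0// => /andP[? ?]; lra.
have := permuton_increment1 y z01 x01 zx.
by rewrite ger0_norm ?subr_ge0// => /andP[? ?]; lra.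
Qed.

Lemma permuton_fun_lip2 (y z x : R) : 0 <= y <= 1 -> 0 <= z <= 1 ->
  permuton_fun mu z x <= permuton_fun mu y x + `|z - y|.
Proof.
move=> y01 z01; rewrite /permuton_fun; have [yz|/ltW zy] := leP y z.
  have := permuton_increment2 x y01 z01 yz.
  by rewrite ger0_norm ?subr_ge0// => /andP[? ?]; lra.
have := permuton_increment2 x z01 y01 zy.
by rewrite ler0_norm ?subr_le0// => /andP[? ?]; lra.
Qed.

End PermutonFun.

(** * Permuton ideals *)

Lemma pt_itv01 (R : realType) (x : pt R) : 0 <= \val x <= 1.
Proof.
have := set_mem (valP x).
by rewrite /= in_itv/= => /andP[/ltW -> /ltW ->].
Qed.

(** The zero morphism is not path like, but belongs to every span. *)
Lemma lin_span_composite (R : realType) (k : fieldType) (y x : pt R)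
    (f : R -> R) (p : Lambda k y x) l :
  composite p l -> f (\val x) <= l -> Dsub k f y x p.
Proof.
move=> pl fxl; have [->|p0] := eqVneq p 0; first exact: lin_span0.
by apply: sub_lin_span; exists l.
Qed.

Theorem proposition7p3 (k : closedFieldType) (R : realType)
    (mu : {measure set (borelI R * borelI R) -> \bar R}%R) :
  permuton mu -> two_sided_ideal (permuton_ideal k mu).
Proof.
move=> permuton_mu; split=> [y x|y x z g f Jf|z y x f h Jf].
- exact: lin_span_submod_closed.
- apply: (lin_span_mcomp _ (composite_span g) Jf).
  move=> {g f Jf} g f [l gl] [m fm [_ fcomp]].
  apply: lin_span_composite (composite_comp gl fcomp) _.
  apply: le_trans (permuton_fun_lip1 permuton_mu _ (pt_itv01 x) (pt_itv01 z)) _.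
  by rewrite lerD// (composite_length gl).
- apply: (lin_span_mcomp _ Jf (composite_span h)).
  move=> {f h Jf} f h [l fl [_ fcomp]] [m hm].
  apply: lin_span_composite (composite_comp fcomp hm) _.
  apply: le_trans (permuton_fun_lip2 permuton_mu _ (pt_itv01 y) (pt_itv01 z)) _.
  by rewrite lerD// (composite_length hm).
Qed.
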